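(* Let $n\ge 1$, let $G=(V,E)$ be a graph on $n$ vertices, let $H_C=\sum_{\langle i,j\rangle\in E}\sigma^z_i\sigma^z_j$ and $H_B=-\sum_{i=1}^n\sigma^x_i$ acting on $(\mathbb{C}^2)^{\otimes n}$. For $q\ge 1$ and $(\boldsymbol\beta,\boldsymbol\gamma)\in\mathbb{R}^q\times\mathbb{R}^q$ define $$|\boldsymbol\beta,\boldsymbol\gamma\rangle = e^{-\mathrm{i}\beta_q H_B}e^{-\mathrm{i}\gamma_q H_C}\cdots e^{-\mathrm{i}\beta_1 H_B}e^{-\mathrm{i}\gamma_1 H_C}\,|+\rangle^{\otimes n},\qquad E_q(\boldsymbol\beta,\boldsymbol\gamma)=\langle\boldsymbol\beta,\boldsymbol\gamma|H_C|\boldsymbol\beta,\boldsymbol\gamma\rangle .$$ Let $p\ge 1$ and let $\boldsymbol\Gamma^p_{\min}=(\beta_1^\star,\ldots,\beta_p^\star,\gamma_1^\star,\ldots,\gamma_p^\star)$ be a local minimum of $E_p:\mathbb{R}^{2p}\to\mathbb{R}$. For $i\in[1,p+1]$ and $j\in\{i,i+1\}$ with $j\le p+1$, define the point of $\mathbb{R}^{2(p+1)}$ $$\boldsymbol\Gamma^{p+1}_{\mathrm{TS}}(i,j)=(\beta_1^\star,\ldots,\beta_{i-1}^\star,0,\beta_i^\star,\ldots,\beta_p^\star,\ \gamma_1^\star,\ldots,\gamma_{j-1}^\star,0,\gamma_j^\star,\ldots,\gamma_p^\star),$$ i.e. a zero is inserted at position $i$ of the $\beta$-vector and at position $j$ of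 the $\gamma$-vector (these are $2p+1$ points). Then each of these $2p+1$ points is either (i) a transition state of $E_{p+1}$, or (ii) a point at which the Hessian of $E_{p+1}$ is singular.
   Context: $|+\rangle=(|0\rangle+|1\rangle)/\sqrt2$ and $\sigma^x_i,\sigma^z_i$ are the Pauli matrices acting on the $i$-th qubit. The first $q$ coordinates of a point in $\mathbb{R}^{2q}$ are $\beta_1,\ldots,\beta_q$ and the last $q$ are $\gamma_1,\ldots,\gamma_q$. A transition state of a smooth function $F:\mathbb{R}^m\to\mathbb{R}$ is a stationary point ($\nabla F=0$) at which the Hessian matrix $\partial_a\partial_b F$ has exactly one negative eigenvalue and all other eigenvalues positive. *)

(* Defs.v *)
From HB Require Import structures.
From mathcomp Require Import all_boot all_order all_algebra.
From mathcomp Require Import all_classical all_reals all_analysis.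
From mathcomp Require Import complex.
Set Implicit Arguments.
Unset Strict Implicit.
Unset Printing Implicit Defensive.
Import Order.TTheory GRing.Theory Num.Theory.
Import numFieldTopology.Exports numFieldNormedType.Exports.
Local Open Scope ring_scope.
Local Open Scope complex_scope.

(* The library gives no topology to complex R; equip it with the standard
   (norm) topology of the numClosedField R[i], so that limits of sequences of
   complex matrices (hence the matrix exponential series) make sense. *)
HB.instance Definition _ (R : rcfType) :=
  PseudoPointedMetric.copy (complex R) (R[i] : numClosedFieldType)^o.

Section QAOA.
Variable R : realType.
Local Notation C := R[i].

Definition mxpow {N : nat} (A : 'M[C]_N) (k : nat) : 'M[C]_N :=
  iter k (mulmx A) 1%:M.

Definition expm {N : nat} (A : 'M[C]_N) : 'M[C]_N :=
  limn (series (fun k : nat => (k`!%:R)^-1 *: mxpow A k)).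

(* ---------- the n-qubit Hilbert space (C^2)^{(x) n} = C^(2^n) ----------
   Basis vector r : 'I_(2^n) is |b_0 b_1 ... b_{n-1}>, where the state of
   qubit k is the k-th binary digit of r. *)
Definition qbit (k r : nat) : bool := odd (r %/ 2 ^ k).

Definition sigma_z (n : nat) (k : 'I_n) : 'M[C]_(2 ^ n) :=
  \matrix_(r, c) (if r == c then (if qbit k r then -1 else 1) else 0).

Definition sigma_x (n : nat) (k : 'I_n) : 'M[C]_(2 ^ n) :=
  \matrix_(r, c)
    (if [forall l : 'I_n, (qbit l r == qbit l c) == (l != k)] then 1 else 0).

(* H_C = sum over the edges <i,j> of the graph (each edge once) of Z_i Z_j.
   The graph on vertex set 'I_n is given by a symmetric irreflexive relation e. *)
Definition H_C (n : nat) (e : rel 'I_n) : 'M[C]_(2 ^ n) :=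
  \sum_(i < n) \sum_(j < n | (i < j)%N && e i j) (sigma_z i *m sigma_z j).

Definition H_B (n : nat) : 'M[C]_(2 ^ n) := - \sum_(k < n) sigma_x k.

Definition plus_state (n : nat) : 'cV[C]_(2 ^ n) :=
  const_mx (((Num.sqrt (2 : R))^-1) ^+ n)%:C.

(* |beta,gamma> for x = (beta_1..beta_q, gamma_1..gamma_q) in R^(q+q):
   e^{-i beta_q H_B} e^{-i gamma_q H_C} ... e^{-i beta_1 H_B} e^{-i gamma_1 H_C} |+>^n
   (layer 1, i.e. index 0, is applied first). *)
Definition qaoa_state (n : nat) (e : rel 'I_n) (q : nat) (x : 'rV[R]_(q + q))
  : 'cV[C]_(2 ^ n) :=
  foldl (fun v (k : 'I_q) =>
           expm ((- 'i * ((lsubmx x) 0 k)%:C) *: H_B n)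
             *m (expm ((- 'i * ((rsubmx x) 0 k)%:C) *: H_C e) *m v))
        (plus_state n) (enum 'I_q).

(* E_q(beta,gamma) = <beta,gamma| H_C |beta,gamma>  (a real number; we take
   the real part of the complex scalar, which is real since H_C is Hermitian) *)
Definition energy (n : nat) (e : rel 'I_n) (q : nat) (x : 'rV[R]_(q + q)) : R :=
  let psi := qaoa_state e x in
  @complex.Re R (((map_mx conjc psi)^T *m H_C e *m psi) 0 0).

Definition partial {m : nat} (F : 'rV[R]_m -> R) (a : 'I_m) (x : 'rV[R]_m) : R :=
  'D_(delta_mx 0 a) F x.

Definition hessian {m : nat} (F : 'rV[R]_m -> R) (x : 'rV[R]_m) : 'M[R]_m :=
  \matrix_(a, b) partial (partial F b) a x.

Definition stationary {m : nat} (F : 'rV[R]_m -> R) (x : 'rV[R]_m) : Prop :=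
  forall a : 'I_m, partial F a x = 0.

Definition transition_state {m : nat} (F : 'rV[R]_m -> R) (x : 'rV[R]_m) : Prop :=
  stationary F x /\
  exists lam : R, [/\ lam < 0, eigenvalue (hessian F x) lam,
    mup lam (char_poly (hessian F x)) = 1%N &
    forall mu : R, eigenvalue (hessian F x) mu -> mu != lam -> 0 < mu].

Definition local_min {m : nat} (F : 'rV[R]_m -> R) (x : 'rV[R]_m) : Prop :=
  \forall y \near x, F x <= F y.

Definition insert0 {p : nat} (v : 'rV[R]_p) (i : 'I_p.+1) : 'rV[R]_p.+1 :=
  \row_(k < p.+1) oapp (v 0) 0 (unlift i k).

Definition ts_point {p : nat} (x : 'rV[R]_(p + p)) (i j : 'I_p.+1)
  : 'rV[R]_(p.+1 + p.+1) :=
  row_mx (insert0 (lsubmx x) i) (insert0 (rsubmx x) j).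

End QAOA.

(* Main.v *)
Require Import Defs.
From HB Require Import structures.
From mathcomp Require Import all_boot all_order all_algebra.
From mathcomp Require Import all_classical all_reals all_analysis.
From mathcomp Require Import complex.
Import Order.TTheory GRing.Theory Num.Theory.
Import numFieldTopology.Exports numFieldNormedType.Exports.
Local Open Scope ring_scope.
Set Implicit Arguments.
Unset Strict Implicit.
Unset Printing Implicit Defensive.
Local Open Scope complex_scope.
Local Open Scope classical_set_scope.

(** If gamma_j = 0, the two neighbouring mixers e^{-i beta H_B} merge (for the
    first layer the mixer only multiplies |+> by a phase), so on the hyperplane
    gamma_j = 0 the energy E_{p+1} is E_p composed with a linear map. Likewise,
    if beta_i = 0, the two neighbouring factors e^{-i gamma H_C} merge (in the
    last layer the factor commutes with H_C), so E_{p+1} is E_p composed with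
    another linear map. Both maps send the point of the theorem to the local
    minimum, hence that point is stationary and its Hessian is nonnegative on
    the hyperplane gamma_j = 0; the first map has a nontrivial kernel, which
    gives a nonzero direction where the Hessian form vanishes. A nonsingular
    symmetric matrix which is nonnegative on a hyperplane but not positive
    definite has exactly one negative eigenvalue. *)

(** * Trigonometric polynomials *)

(** If [g2 0 < 0], continuity keeps [g2] negative near 0. Since [g1 0 = 0], [g1] is then negative
    just to the right of 0, so [g] strictly decreases there, against minimality. *)
Lemma second_order_min (R : realType) (g g1 g2 : R -> R) :
  (forall t, is_derive t (1 : R) g (g1 t)) ->
  (forall t, is_derive t (1 : R) g1 (g2 t)) ->
  {for 0, continuous g2} -> (\forall t \near (0 : R), g 0 <= g t) ->
  g1 0 = 0 /\ 0 <= g2 0.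
Proof.
move=> dg dg1 cg2 /nbhs_ballP[d /= d0 gmin].
have gE t : g^`() t = g1 t by rewrite derive1E; exact: derive_val.
have g1E t : g1^`() t = g2 t by rewrite derive1E; exact: derive_val.
have gd t : derivable g t 1 by exact: ex_derive.
have g1d t : derivable g1 t 1 by exact: ex_derive.
have cont (h : R -> R) : (forall t, derivable h t 1) -> continuous h.
  by move=> hd t; exact/differentiable_continuous/derivable1_diffP.
have ballE t : -d < t < d -> ball (0 : R) d t.
  by move=> td; rewrite /ball /= sub0r normrN ltr_norml.
have g10 : g1 0 = 0.
  have : is_derive (0 : R) (1 : R) g 0.
    apply: (@derive1_at_min _ g (-d) d 0) => //.
    - by rewrite ge0_cp // ltW.
    - by rewrite in_itv /= oppr_lt0 d0.
    - by move=> t; rewrite in_itv => /ballE /gmin.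
  by move=> h; rewrite -gE derive1E; exact: derive_val.
split => //; rewrite leNgt; apply/negP => g20.
have /nbhs_ballP[r /= r0 g2neg] : \forall t \near (0 : R), g2 t < 0.
  exact: cvgr_lt cg2 _ g20.
(* [s] lies strictly inside both radii: minimality of [g 0] holds up to [d], negativity of [g2] up
   to [r]. *)
pose s := Num.min d r / 2.
have m0 : 0 < Num.min d r by rewrite lt_min d0 r0.
have s0 : 0 < s by rewrite divr_gt0.
have [sd sr] : s < d /\ s < r.
  have : s < Num.min d r by rewrite /s ltr_pdivrMr // ltr_pMr // ltr1n.
  by rewrite lt_min => /andP.
have g1neg t : t \in `]0, s[%R -> g1 t < 0.
  rewrite in_itv /= => /andP[t0 ts]; rewrite -g10.
  apply: (@ltr0_derive1_lt_cc _ g1 0 t) => //.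
  - move=> u; rewrite in_itv /= g1E => /andP[u0 ut]; apply: g2neg.
    by rewrite /ball /= sub0r normrN gtr0_norm // (lt_trans ut) // (lt_trans ts).
  - exact/continuous_subspaceT/cont.
  - by rewrite in_itv /= ltW // lexx.
  - by rewrite in_itv /= lexx ltW.
have : g s < g 0.
  apply: (@ltr0_derive1_lt_cc _ g 0 s) => //.
  - by move=> u /g1neg; rewrite gE.
  - exact/continuous_subspaceT/cont.
  - by rewrite in_itv /= ltW // lexx.
  - by rewrite in_itv /= lexx ltW.
by rewrite ltNge gmin //; apply: ballE; rewrite sd andbT (lt_trans _ s0) // oppr_lt0.
Qed.

(** The difference quotient of the restriction at [t] is that of the directional derivative at the
    point of parameter [t]. *)
Lemma is_derive_line (R : realType) (m : nat) (f : 'rV[R]_m -> R)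
    (x v : 'rV[R]_m) (t : R) :
  differentiable f (t *: v + x) ->
  is_derive t (1 : R) (fun s : R => f (s *: v + x)) ('D_v f (t *: v + x)).
Proof.
move=> df.
have E : (fun h : R => h^-1 *: (f ((h *: (1 : R) + t) *: v + x) - f (t *: v + x)))
  = (fun h : R => h^-1 *: (f (h *: v + (t *: v + x)) - f (t *: v + x))).
  by apply/funext => h; rewrite scalerDl -addrA /GRing.scale /= mulr1.
have dl : derivable f (t *: v + x) v by exact: diff_derivable.
apply: DeriveDef; first by rewrite /derivable /= E.
by rewrite /derive /= E.
Qed.

(* The energy lies in this class, which is closed under directional
   derivatives; smoothness and the symmetry of the Hessian follow by induction. *)
Inductive trigpoly (R : realType) (m : nat) : ('rV[R]_m -> R) -> Prop :=
| trig_cst c : trigpoly (fun=> c)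
| trig_cos c k : trigpoly (fun x => cos (c * x 0 k))
| trig_sin c k : trigpoly (fun x => sin (c * x 0 k))
| trig_add f g : trigpoly f -> trigpoly g -> trigpoly (fun x => f x + g x)
| trig_mul f g : trigpoly f -> trigpoly g -> trigpoly (fun x => f x * g x).

Section trigpoly_derive.
Variables (R : realType) (m : nat).
Implicit Types (f g : 'rV[R]_m -> R) (x v w : 'rV[R]_m).

Lemma is_diff_scoord (c : R) (k : 'I_m) x :
  is_diff x (fun y : 'rV[R]_m => c * y 0 k) (fun v => c * v 0 k).
Proof.
have lin : linear (fun y : 'rV[R]_m => y 0 k : R) by move=> a u v; rewrite !mxE.
pose lM := GRing.isLinear.Build _ _ _ _ (fun y : 'rV[R]_m => y 0 k : R) lin.
pose l : {linear 'rV[R]_m -> R} := HB.pack (fun y : 'rV[R]_m => y 0 k : R) lM.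
have lc : continuous l by exact: coord_continuous.
have dl : is_diff x l l.
  by apply: DiffDef; [exact: linear_differentiable | rewrite diff_lin].
exact: (@is_diffZ _ _ _ l l c x dl).
Qed.

Lemma is_diff_comp_scoord (h : R -> R) (h' c : R) (k : 'I_m) x :
  is_derive (c * x 0 k) (1 : R) h h' ->
  is_diff x (fun y : 'rV[R]_m => h (c * y 0 k)) (fun v => h' * (c * v 0 k)).
Proof.
move=> dh; have hd : derivable h (c * x 0 k) 1 by exact: ex_derive.
have dh' : is_diff (c * x 0 k) h ( *:%R^~ h').
  apply: DiffDef; first exact/derivable1_diffP.
  by rewrite deriv1E // derive1E derive_val.
have := @is_diff_comp _ _ _ _ _ _ _ _ _ (is_diff_scoord c k x) dh'.
by congr (is_diff _ _ _); apply/funext => v /=; rewrite /GRing.scale /= mulrC.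
Qed.

Lemma trig_differentiable f x : trigpoly f -> differentiable f x.
Proof.
elim=> {f} [c|c k|c k|f g _ df _ dg|f g _ df _ dg].
- exact: differentiable_cst.
- have [] // := is_diff_comp_scoord (is_derive_cos (c * x 0 k)).
- have [] // := is_diff_comp_scoord (is_derive_sin (c * x 0 k)).
- exact: differentiableD.
- exact: differentiableM.
Qed.

Lemma trig_derivable f x v : trigpoly f -> derivable f x v.
Proof. by move=> /trig_differentiable df; exact: diff_derivable. Qed.

Lemma derive_trig_cos c k v :
  'D_v (fun x : 'rV[R]_m => cos (c * x 0 k)) = fun x => - (c * v 0 k) * sin (c * x 0 k).
Proof.
apply/funext => x; have [dc dE] := is_diff_comp_scoord (is_derive_cos (c * x 0 k)).
by rewrite deriveE // dE mulNr mulrC mulNr.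
Qed.

Lemma derive_trig_sin c k v :
  'D_v (fun x : 'rV[R]_m => sin (c * x 0 k)) = fun x => (c * v 0 k) * cos (c * x 0 k).
Proof.
apply/funext => x; have [dc dE] := is_diff_comp_scoord (is_derive_sin (c * x 0 k)).
by rewrite deriveE // dE mulrC.
Qed.

Lemma derive_trig_add f g v : trigpoly f -> trigpoly g ->
  'D_v (fun x => f x + g x) = fun x => 'D_v f x + 'D_v g x.
Proof.
move=> tf tg; apply/funext => x.
by have := deriveD (@trig_derivable f x v tf) (@trig_derivable g x v tg).
Qed.

Lemma derive_trig_mul f g v : trigpoly f -> trigpoly g ->
  'D_v (fun x => f x * g x) = fun x => f x * 'D_v g x + g x * 'D_v f x.
Proof.
move=> tf tg; apply/funext => x.
by have := deriveM (@trig_derivable f x v tf) (@trig_derivable g x v tg).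
Qed.

Lemma derive_trig_cst c v : 'D_v (fun x : 'rV[R]_m => c : R) = fun=> 0.
Proof. by apply/funext => x; rewrite derive_cst. Qed.

Lemma derive_trig_mulc c f v : trigpoly f ->
  'D_v (fun x => c * f x) = fun x => c * 'D_v f x.
Proof.
move=> tf; rewrite (derive_trig_mul v (trig_cst m c) tf).
by apply/funext => x; rewrite derive_cst mulr0 addr0.
Qed.

Lemma trig_derive f v : trigpoly f -> trigpoly ('D_v f).
Proof.
elim=> {f} [c|c k|c k|f g tf df tg dg|f g tf df tg dg].
- by rewrite derive_trig_cst; constructor.
- by rewrite derive_trig_cos; apply: trig_mul; constructor.
- by rewrite derive_trig_sin; apply: trig_mul; constructor.
- by rewrite derive_trig_add //; apply: trig_add.
- by rewrite derive_trig_mul //; apply: trig_add; exact: trig_mul.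
Qed.

Lemma derive2_trig_add f g v w : trigpoly f -> trigpoly g ->
  'D_v ('D_w (fun x => f x + g x)) = fun x => 'D_v ('D_w f) x + 'D_v ('D_w g) x.
Proof.
move=> tf tg; transitivity ('D_v (fun x => 'D_w f x + 'D_w g x)).
  by congr (fun h : 'rV[R]_m -> R => 'D_v h); exact: derive_trig_add.
exact: derive_trig_add (trig_derive w tf) (trig_derive w tg).
Qed.

Lemma derive2_trig_mul f g v w : trigpoly f -> trigpoly g ->
  'D_v ('D_w (fun x => f x * g x)) = fun x =>
    (f x * 'D_v ('D_w g) x + 'D_w g x * 'D_v f x) +
    (g x * 'D_v ('D_w f) x + 'D_w f x * 'D_v g x).
Proof.
move=> tf tg; have tdf := trig_derive w tf; have tdg := trig_derive w tg.
transitivity ('D_v (fun x => f x * 'D_w g x + g x * 'D_w f x)).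
  by congr (fun h : 'rV[R]_m -> R => 'D_v h); exact: derive_trig_mul.
have fg := derive_trig_mul v tf tdg; have gf := derive_trig_mul v tg tdf.
have := derive_trig_add v (trig_mul tf tdg) (trig_mul tg tdf).
move=> ->; apply/funext => x; congr (_ + _).
  exact: (f_equal (fun h : 'rV[R]_m -> R => h x) fg).
exact: (f_equal (fun h : 'rV[R]_m -> R => h x) gf).
Qed.

(* The proof chains equations with [etrans]: rewriting with them would make
   unification unfold the limits behind ['D_v]. *)
Lemma trig_deriveC f v w : trigpoly f ->
  'D_v ('D_w f) = 'D_w ('D_v f) :> ('rV[R]_m -> R).
Proof.
elim=> {f} [c|c k|c k|f g tf df tg dg|f g tf df tg dg].
- have D0 u u' : 'D_u ('D_u' (fun=> c : R)) = (fun=> 0) :> ('rV[R]_m -> R).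
    exact: etrans (congr1 (fun f => 'D_u f) (derive_trig_cst c u')) (derive_trig_cst 0 u).
  exact: etrans (D0 v w) (esym (D0 w v)).
- have Dc := derive_trig_cos c k; have Ds := derive_trig_sin c k.
  have D u u' : 'D_u ('D_u' (fun x : 'rV[R]_m => cos (c * x 0 k))) =
      fun x => - (c * u' 0 k) * ((c * u 0 k) * cos (c * x 0 k)).
    rewrite Dc; refine (etrans (derive_trig_mulc _ _ (trig_sin c k)) _).
    by apply/funext => x; congr (_ * _); exact: (f_equal (@^~ x) (Ds u)).
  refine (etrans (D v w) (etrans _ (esym (D w v)))).
  by apply/funext => x; rewrite !mulNr mulrCA.
- have Dc := derive_trig_cos c k; have Ds := derive_trig_sin c k.
  have D u u' : 'D_u ('D_u' (fun x : 'rV[R]_m => sin (c * x 0 k))) =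
      fun x => (c * u' 0 k) * (- (c * u 0 k) * sin (c * x 0 k)).
    rewrite Ds; refine (etrans (derive_trig_mulc _ _ (trig_cos c k)) _).
    by apply/funext => x; congr (_ * _); exact: (f_equal (@^~ x) (Dc u)).
  refine (etrans (D v w) (etrans _ (esym (D w v)))).
  by apply/funext => x; rewrite !mulNr !mulrN mulrCA.
- refine (etrans (derive2_trig_add v w tf tg) (etrans _ (esym (derive2_trig_add w v tf tg)))).
  apply/funext => x; have at_x := f_equal (fun h : 'rV[R]_m -> R => h x).
  exact: (f_equal2 +%R (at_x _ _ df) (at_x _ _ dg)).
- refine (etrans (derive2_trig_mul v w tf tg) (etrans _ (esym (derive2_trig_mul w v tf tg)))).
  (* Exchanging [v] and [w] swaps the two cross terms of the Leibniz formula; the other two terms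
     agree by induction. *)
  have leibniz (F G a a' b b' p q r s : R) : a = a' -> b = b' ->
      F * a + p * q + (G * b + r * s) = F * a' + s * r + (G * b' + q * p).
    by move=> -> ->; rewrite addrACA [RHS]addrACA [p * q + _]addrC (mulrC p) (mulrC r).
  apply/funext => x; have at_x := f_equal (fun h : 'rV[R]_m -> R => h x).
  exact: (leibniz _ _ _ _ _ _ _ _ _ _ (at_x _ _ dg) (at_x _ _ df)).
Qed.

Lemma derive_coord f x v : differentiable f x ->
  'D_v f x = \sum_k v 0 k * partial f k x.
Proof.
move=> df; rewrite deriveE // {1}(row_sum_delta v) linear_sum.
by apply: eq_bigr => k _; rewrite linearZ /= /partial deriveE.
Qed.

Lemma trig_hessian_sym f x : trigpoly f -> (hessian f x)^T = hessian f x.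
Proof.
move=> tf; apply/matrixP => a b; rewrite !mxE.
exact: (f_equal (fun h : 'rV[R]_m -> R => h x) (trig_deriveC _ _ tf)).
Qed.

(** Both directional derivatives expand over the coordinates; commuting ['D_v] with [partial] allows
    the second expansion. The quadratic form thereby becomes a second derivative along a line. *)
Lemma trig_hessian_form f x v : trigpoly f ->
  (v *m hessian f x *m v^T) 0 0 = 'D_v ('D_v f) x.
Proof.
move=> tf; have dd (u : 'rV[R]_m) : differentiable ('D_u f) x.
  exact/trig_differentiable/trig_derive.
refine (etrans _ (esym (derive_coord v (dd v)))).
rewrite mxE; apply: eq_bigr => a _; rewrite mxE mulrC mxE; congr (_ * _).
have -> : partial ('D_v f) a x = 'D_v (partial f a) x.
  exact: (f_equal (fun h : 'rV[R]_m -> R => h x) (trig_deriveC _ _ tf)).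
refine (etrans _ (esym (derive_coord v (dd (delta_mx 0 a))))).
by apply: eq_bigr => b _; rewrite mxE.
Qed.

Lemma trig_line f x v (t : R) : trigpoly f ->
  is_derive t (1 : R) (fun s : R => f (s *: v + x)) ('D_v f (t *: v + x)).
Proof. by move=> tf; exact: is_derive_line (@trig_differentiable f _ tf). Qed.

(** On a line, [f] is a one-variable function whose derivatives are the iterated ['D_v], so
    [second_order_min] applies at parameter 0. Working one direction at a time suits a minimality
    known only on a hyperplane. *)
Lemma trig_line_min f x v : trigpoly f ->
  (\forall t \near (0 : R), f x <= f (t *: v + x)) ->
  'D_v f x = 0 /\ 0 <= (v *m hessian f x *m v^T) 0 0.
Proof.
move=> tf fmin; rewrite trig_hessian_form //.
have tdf := trig_derive v tf; have tddf := trig_derive v tdf.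
have cont : {for 0, continuous (fun s : R => 'D_v ('D_v f) (s *: v + x))}.
  apply/differentiable_continuous/derivable1_diffP.
  by have [] := trig_line x v 0 tddf.
have x0 : 0 *: v + x = x by rewrite scale0r add0r.
have gmin : \forall t \near (0 : R), f (0 *: v + x) <= f (t *: v + x) by rewrite x0.
have := second_order_min (fun t => trig_line x v t tf) (fun t => trig_line x v t tdf) cont gmin.
by rewrite x0.
Qed.

(** ['D_v f] vanishes on the whole line, hence so does its own derivative along [v]. *)
Lemma trig_line_cst f x v : trigpoly f -> (forall t : R, f (t *: v + x) = f x) ->
  (v *m hessian f x *m v^T) 0 0 = 0.
Proof.
move=> tf fcst; rewrite trig_hessian_form //.
have cst_line h (c : R) (t : R) : trigpoly h -> (forall s : R, h (s *: v + x) = c) ->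
    'D_v h (t *: v + x) = 0.
  move=> th hc; have [_ <-] := trig_line x v t th.
  rewrite (_ : (fun s : R => h (s *: v + x)) = cst c); first exact: derive_cst.
  by apply/funext.
(* [x] is the point of parameter 0; [cst_line] is used twice, first for ['D_v f] with constant 0,
   then for [f] with constant [f x]. *)
rewrite -[x]add0r -(scale0r v); apply: (cst_line _ 0); first exact: trig_derive.
by move=> s; exact: (cst_line _ (f x)).
Qed.

End trigpoly_derive.

(** * Exponentials of Hermitian matrices *)

(** The products [u l * a l * v l] are the terms of an entry of a diagonalized matrix, where only
    the diagonal varies with [n]. *)
Lemma cvg_linear_comb (K : numFieldType) (I : Type) (r : seq I) (u v : I -> K)
    (f : I -> nat -> K) (a : I -> K) :
  (forall l, f l @ \oo --> a l) ->
  (fun n => \sum_(l <- r) u l * f l n * v l) @ \oo --> \sum_(l <- r) u l * a l * v l.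
Proof.
move=> fa; elim: r => [|l r IH].
  rewrite big_nil [X in X @ _ --> _](_ : _ = fun=> 0); first exact: cvg_cst.
  by apply/funext => n; rewrite big_nil.
rewrite big_cons [X in X @ _ --> _](_ : _ = fun n => u l * f l n * v l +
  \sum_(l <- r) u l * f l n * v l); last first.
  by apply/funext => n; rewrite big_cons.
by apply: cvgD IH; apply: cvgMr_tmp; apply: cvgMl_tmp.
Qed.

(** * Convergence of complex numbers and matrices, by components *)

Section complex_limits.
Variable R : realType.
Local Notation C := R[i].

Lemma complexM_hausdorff (m n : nat) : hausdorff_space 'M[C]_(m, n).
Proof. exact: (@norm_hausdorff _ 'M[((C : numClosedFieldType)^o : normedModType _)]_(m, n)). Qed.

Lemma cvg_complex (u : nat -> C) (l : C) :
  (fun k => complex.Re (u k)) @ \oo --> complex.Re l ->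
  (fun k => complex.Im (u k)) @ \oo --> complex.Im l ->
  u @ \oo --> l.
Proof.
move=> cRe cIm.
suff : (u : nat -> (C : numClosedFieldType)^o) @ \oo --> (l : (C : numClosedFieldType)^o) by [].
apply/cvgrPdist_lt => e e0.
(* A positive element of [C] has zero imaginary part, so [e] is a positive real and can be halved
   between the two components. *)
have [eR e0'] : e = (complex.Re e)%:C /\ 0 < complex.Re e.
  move: e0; rewrite ltcE /= => /andP[/eqP ei er]; split => //.
  by move: ei {er}; case: (e) => a b /= ->.
have e2 : 0 < complex.Re e / 2 by rewrite divr_gt0.
move/cvgrPdist_lt : cRe => /(_ _ e2) nRe; move/cvgrPdist_lt : cIm => /(_ _ e2) nIm.
near=> k.
have hR : `|complex.Re l - complex.Re (u k)| < complex.Re e / 2 by near: k.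
have hI : `|complex.Im l - complex.Im (u k)| < complex.Re e / 2 by near: k.
have -> : l - u k = (complex.Re l - complex.Re (u k))%:C
   + 'i%C * (complex.Im l - complex.Im (u k))%:C.
  by rewrite [LHS]complexE; case: (l) => ? ?; case: (u k) => ? ?.
apply: le_lt_trans (ler_normD _ _) _; rewrite normrM complexiE normCi mul1r.
have nC (a : R) : `|a%:C| = `|a|%:C :> C.
  by rewrite normc_def /= expr0n /= addr0 sqrtr_sqr.
by rewrite eR !nC -rmorphD /= ltcR (splitr (complex.Re e)) ltrD.
Unshelve. all: by end_near. Qed.

(** A neighbourhood of [M] contains a product of neighbourhoods of its finitely many entries. *)
Lemma cvg_complexM (m n : nat) (u : nat -> 'M[C]_(m, n)) (M : 'M[C]_(m, n)) :
  (forall i j, (fun k => u k i j) @ \oo --> M i j) -> u @ \oo --> M.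
Proof.
move=> uM A [P MP sPA].
have : \forall k \near \oo, forall i j, P i j (u k i j).
  by apply: filter_forall => i; apply: filter_forall => j; exact: uM (MP i j).
by apply: filterS => k Pk; exact: sPA.
Qed.

End complex_limits.

Section unitary_evolution.
Variable R : realType.
Local Notation C := R[i].
Local Open Scope sesquilinear_scope.

Definition cis (t : R) : C := cos t +i* sin t.

Lemma cis0 : cis 0 = 1. Proof. by rewrite /cis cos0 sin0. Qed.

Lemma cisD a b : cis (a + b) = cis a * cis b.
Proof. by rewrite /cis cosD sinD; simpc; rewrite [in X in _ +i* X]addrC. Qed.

Lemma conj_cis a : (cis a)^*%C = cis (- a).
Proof. by rewrite /cis /= cosN sinN. Qed.

(** By parity of [k]: even powers of the imaginary unit are real and give the cosine series, odd
    powers are imaginary and give the sine series. *)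
Lemma exp_i_coeff (y : R) (k : nat) :
  (k`!%:R)^-1 * ('i%C * y%:C) ^+ k = cos_coeff y k +i* sin_coeff y k :> C.
Proof.
have iE : 'i%C ^+ k = (~~ odd k)%:R * (-1) ^+ k./2 +i* ((odd k)%:R * (-1) ^+ k.-1./2) :> C.
  have dblE m : 'i%C ^+ m.*2 = ((-1) ^+ m)%:C :> C.
    by rewrite -mul2n exprM sqr_i rmorphXn rmorphN1.
  case: (boolP (odd k)) => [ok|ek] /=; last first.
    by rewrite -[in LHS](even_halfK ek) dblE mul1r mul0r.
  have k0 : k = (k.-1./2).*2.+1.
    by case: k ok => //= k ek; rewrite even_halfK.
  by rewrite [in LHS]k0 exprS dblE mul0r mul1r; simpc.
rewrite exprMn iE -rmorphXn -[k`!%:R]/(k`!%:R : C) -(rmorph_nat (real_complex R)) -fmorphV /=.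
rewrite /cos_coeff /sin_coeff /=; simpc.
by congr (_ +i* _); rewrite mulrC.
Qed.

Lemma cvg_exp_i (y : R) :
  series (fun k => (k`!%:R)^-1 * ('i%C * y%:C) ^+ k : C) @ \oo --> cis y.
Proof.
have sE n : series (fun k => (k`!%:R)^-1 * ('i%C * y%:C) ^+ k : C) n =
    series (cos_coeff y) n +i* series (sin_coeff y) n.
  elim: n => [|n IH]; first by rewrite /series /= !big_geq.
  by rewrite !seriesSr IH exp_i_coeff; simpc.
have cc : series (cos_coeff y) @ \oo --> cos y.
  by rewrite cos.unlock; exact: is_cvg_series_cos_coeff.
have cs : series (sin_coeff y) @ \oo --> sin y.
  by rewrite sin.unlock; exact: is_cvg_series_sin_coeff.
apply: cvg_complex.
  rewrite [X in X @ _ --> _](_ : _ = series (cos_coeff y)) //.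
  by apply/funext => n; rewrite sE.
rewrite [X in X @ _ --> _](_ : _ = series (sin_coeff y)) //.
by apply/funext => n; rewrite sE.
Qed.

(** The evolution e^{-itA}, written as in [qaoa_state] so that the two agree by conversion. *)
Definition evo (N : nat) (A : 'M[C]_N) (t : R) : 'M[C]_N := expm ((- 'i * t%:C) *: A).

Section diagonalized.
Variables (N : nat) (P Q : 'M[C]_N) (d : 'I_N -> R).
Hypothesis PQ : P *m Q = 1%:M.
Let A := Q *m diag_mx (\row_k (d k)%:C) *m P.

Lemma mxpow_diagonalized (c : C) (k : nat) :
  mxpow (c *: A) k = Q *m diag_mx (\row_l (c * (d l)%:C) ^+ k) *m P.
Proof.
have QP : Q *m P = 1%:M by exact: mulmx1C.
elim: k => [|k IH].
  rewrite /mxpow /= (_ : diag_mx _ = 1%:M) ?mulmx1 //.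
  by apply/matrixP => i j; rewrite !mxE expr0.
rewrite [LHS]/(mxpow _ _) iterS -/(mxpow _ k) IH /A.
rewrite -scalemxAl -!mulmxA (mulmxA P Q) PQ mul1mx (mulmxA (diag_mx _)) mulmx_diag.
rewrite scalemxAr scalemxAl.
congr (Q *m (_ *m P)); apply/matrixP => i j; rewrite !mxE exprS.
by rewrite mulrnAr mulrA.
Qed.

(** Conjugation by [P] and [Q] commutes with partial sums, so the exponential series splits into one
    scalar series per eigenvalue, and the limit is taken entry by entry. *)
Lemma evo_diagonalized (t : R) :
  evo A t = Q *m diag_mx (\row_l cis (- (t * d l))) *m P.
Proof.
apply: cvg_lim; first exact: complexM_hausdorff.
apply: cvg_complexM => i j.
pose z l k : C := (k`!%:R)^-1 * ('i%C * (- (t * d l))%:C) ^+ k.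
have sE n : series (fun k => (k`!%:R)^-1 *: mxpow ((- 'i * t%:C) *: A) k) n =
   Q *m diag_mx (\row_l series (z l) n) *m P.
  elim: n => [|n IH].
    rewrite /series /= !big_geq // (_ : diag_mx _ = 0) ?mulmx0 ?mul0mx //.
    by apply/matrixP => a b; rewrite !mxE big_geq // mul0rn.
  have D : diag_mx (\row_l series (z l) n.+1) = diag_mx (\row_l series (z l) n)
      + (n`!%:R)^-1 *: diag_mx (\row_l ((- 'i * t%:C) * (d l)%:C) ^+ n).
    rewrite -linearZ -linearD; congr diag_mx; apply/rowP => l; rewrite !mxE seriesSr.
    rewrite /z; congr (_ + _ * _ ^+ _).
    by rewrite -complexiE mulNr rmorphN rmorphM mulNr mulrN mulrA.
  by rewrite seriesSr IH mxpow_diagonalized scalemxAl scalemxAr -mulmxDl -mulmxDr D.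
rewrite [X in X @ _ --> _](_ : _ = fun n => \sum_l Q i l * series (z l) n * P l j); last first.
  apply/funext => n; rewrite sE mxE; apply: eq_bigr => l _; rewrite mul_mx_diag !mxE //.
rewrite mxE; under eq_bigr => l _ do rewrite mul_mx_diag !mxE.
apply: (@cvg_linear_comb (C : numClosedFieldType) _ _ (Q i) (P^~ j) (fun l => series (z l))).
by move=> l; exact: cvg_exp_i.
Qed.

End diagonalized.
End unitary_evolution.

(* Otherwise unification unfolds the limit in [expm]. *)
Opaque evo.

Section evolution_theory.
Variables (R : realType) (N : nat).
Local Notation C := R[i].
Local Open Scope sesquilinear_scope.
Implicit Types (A B : 'M[C]_N) (v w : 'cV[C]_N).

(** Spectral theorem with real eigenvalues. A single pair [P], [d] serves all times [t], so the
    group law, the adjoint and the commutation with [A] reduce to diagonal matrices. *)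
Lemma evo_spectral A : A \is hermsymmx ->
  exists (P : 'M[C]_N) (d : 'I_N -> R), [/\ P *m P^t* = 1%:M,
    A = P^t* *m diag_mx (\row_k (d k)%:C) *m P &
    forall t, evo A t = P^t* *m diag_mx (\row_k cis (- (t * d k))) *m P].
Proof.
move=> hA; have /orthomx_spectralP AE := hermitian_normalmx hA.
move: AE (spectral_unitarymx A) (hermitian_spectral_diag_real hA).
move: (spectralmx A) (spectral_diag A) => P D AE PU /mxOverP Dr.
have PP : P *m P^t* = 1%:M by exact/unitarymxP.
have {}AE : A = P^t* *m diag_mx (\row_k (complex.Re (D 0 k))%:C) *m P.
  rewrite AE (invmx_unitary PU); do 2!congr (_ *m _); congr diag_mx.
  by apply/rowP => k; rewrite mxE RRe_real.
exists P, (fun k => complex.Re (D 0 k)); split; [exact: PP | exact: AE |].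
by move=> t; rewrite AE (evo_diagonalized _ PP).
Qed.

Lemma evo0 A : A \is hermsymmx -> evo A 0 = 1%:M.
Proof.
move=> /evo_spectral[P [d [PP _ ->]]].
rewrite (_ : diag_mx _ = 1%:M) ?mulmx1; first exact: mulmx1C.
by apply/matrixP => i j; rewrite !mxE mul0r oppr0 cis0.
Qed.

Lemma evoD A a b : A \is hermsymmx -> evo A (a + b) = evo A a *m evo A b.
Proof.
move=> /evo_spectral[P [d [PP _ E]]]; rewrite !E.
rewrite -!mulmxA (mulmxA P) PP mul1mx (mulmxA (diag_mx _)) mulmx_diag.
congr (_ *m (diag_mx _ *m _)); apply/rowP => k.
by rewrite !mxE -cisD mulrDl opprD.
Qed.

Lemma evo_comm A t : A \is hermsymmx -> evo A t *m A = A *m evo A t.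
Proof.
move=> /evo_spectral[P [d [PP AE E]]]; rewrite !E {1 2}AE.
rewrite -!mulmxA !(mulmxA P (P^t*)) PP !mul1mx !(mulmxA (diag_mx _) (diag_mx _)) !mulmx_diag.
by congr (_ *m (diag_mx _ *m _)); apply/rowP => k; rewrite !mxE mulrC.
Qed.

Lemma evo_adj A t : A \is hermsymmx -> (evo A t)^t* = evo A (- t).
Proof.
move=> /evo_spectral[P [d [PP _ E]]]; rewrite !E.
rewrite !trmx_mul !map_mxM trmxCK mulmxA tr_diag_mx map_diag_mx.
congr (_ *m diag_mx _ *m _); apply/rowP => k; rewrite !mxE.
by rewrite mulNr; exact: conj_cis.
Qed.

Lemma evo_eigen A t v (a : R) : A \is hermsymmx -> A *m v = a%:C *: v ->
  evo A t *m v = cis (- (t * a)) *: v.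
Proof.
move=> /evo_spectral[P [d [PP AE E]]] Av; rewrite E.
have PPC : P^t* *m P = 1%:M by exact: mulmx1C.
have dv : diag_mx (\row_k (d k)%:C) *m (P *m v) = a%:C *: (P *m v).
  rewrite scalemxAr -Av [in RHS]AE !mulmxA PP mul1mx //.
have ev : diag_mx (\row_k cis (- (t * d k))) *m (P *m v) = cis (- (t * a)) *: (P *m v).
  apply/colP => k; have /colP/(_ k) := dv.
  rewrite !mul_diag_mx !mxE; set z := \sum_j _.
  (* A coordinate of an eigenvector in the eigenbasis either vanishes or belongs to an eigenvalue
     [d k] equal to [a]. *)
  have [->|z0] := eqVneq z 0; first by rewrite !mulr0.
  by move/(mulIf z0)/complexI ->.
by rewrite -!mulmxA ev -scalemxAr mulmxA PPC mul1mx.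
Qed.

Definition expect A v : R := complex.Re ((v^t* *m A *m v) 0 0).

Lemma expect_phase A v t : expect A (cis t *: v) = expect A v.
Proof.
rewrite /expect (_ : (cis t *: v)^t* = cis (- t) *: v^t*); last first.
  by apply/matrixP => i j; rewrite !mxE rmorphM -conj_cis.
by rewrite -!scalemxAl -scalemxAr scalerA -cisD addNr cis0 scale1r.
Qed.

(** [evo A t] is unitary and commutes with [A], so an observable does not see the evolution that it
    generates. *)
Lemma expect_evo A v t : A \is hermsymmx -> expect A (evo A t *m v) = expect A v.
Proof.
move=> hA; have UAU : evo A (- t) *m (A *m evo A t) = A.
  by rewrite -evo_comm // mulmxA -evoD // addNr evo0 // mul1mx.
by rewrite /expect trmx_mul map_mxM evo_adj // -!mulmxA (mulmxA A) (mulmxA (evo A (- t))) UAU.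
Qed.

End evolution_theory.

(** * Alternating products of exponentials *)

Section run.
Variables (R : realType) (N : nat) (A B : 'M[R[i]]_N) (v0 : 'cV[R[i]]_N).
Hypotheses (hA : A \is hermsymmx) (hB : B \is hermsymmx).
Implicit Types (b g : nat -> R) (q i j k : nat).

(** Angles are indexed by [nat], so that deleting a layer is a mere reindexing by [bump]. *)
Fixpoint run b g q : 'cV[R[i]]_N :=
  if q is k.+1 then evo B (b k) *m (evo A (g k) *m run b g k) else v0.

Lemma runS b g q : run b g q.+1 = evo B (b q) *m (evo A (g q) *m run b g q).
Proof. by []. Qed.

(** Common induction step of the two merging lemmas: beyond the merged place the layers agree up to
    a shift of one, and a scalar passes through them. *)
Lemma run_step (c : R[i]) b b' g g' k : b' k = b k.+1 -> g' k = g k.+1 ->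
  run b g k.+1 = c *: run b' g' k -> run b g k.+2 = c *: run b' g' k.+1.
Proof.
move=> bk gk.
have E : run b' g' k.+1 = evo B (b k.+1) *m (evo A (g k.+1) *m run b' g' k).
  by rewrite -bk -gk.
rewrite E !scalemxAr; move: (run b' g' k) => u {E}.
have E : run b g k.+2 = evo B (b k.+1) *m (evo A (g k.+1) *m run b g k.+1) by [].
by rewrite E; move: (run b g k.+1) => w ->.
Qed.

Lemma eq_run b b' g g' q : (forall k, (k < q)%N -> b k = b' k) ->
  (forall k, (k < q)%N -> g k = g' k) -> run b g q = run b' g' q.
Proof.
elim: q => [|q IH] bb gg; first by [].
have bq : b q = b' q by exact: bb.
have gq : g q = g' q by exact: gg.
rewrite /run -/run bq gq IH //; first by move=> k kq; rewrite bb // ltnW.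
by move=> k kq; rewrite gg // ltnW.
Qed.

Lemma bump_lt i k : (k < i)%N -> bump i k = k.
Proof. by move=> ki; rewrite /bump leqNgt ki. Qed.

Lemma bump_ge i k : (i <= k)%N -> bump i k = k.+1.
Proof. by move=> ki; rewrite /bump ki. Qed.

(** With [g j = 0], mixers [j] and [j - 1] are adjacent and their angles add up by [evoD]; for
    [j = 0] the mixer meets its eigenvector [v0]. The layers after [j] are added by induction. *)
Lemma run_merge_beta (a : R) b g j q : B *m v0 = a%:C *: v0 -> g j = 0 -> (j <= q)%N ->
  exists t, run b g q.+1 =
    cis t *: run (fun k => b (bump j k) + (b j) *+ (k.+1 == j)) (g \o bump j) q.
Proof.
move=> Bv0 gj0 jq; set b' := fun k => _; set g' := g \o _.
(* Only the first layer leaves a phase, given by [evo_eigen]; otherwise the factor is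
   [cis 0 = 1]. *)
exists (if j is 0%N then - (b 0%N * a) else 0).
rewrite -(subnK jq) addnC; elim: (q - j)%N => [|n IH].
  rewrite addn0 /= gj0 evo0 // mul1mx.
  case: j @b' @g' gj0 {jq} => [|j] /= gj0; first exact: evo_eigen.
  rewrite cis0 scale1r /= (bump_lt (ltnSn j)) eqxx mulr1n addrC evoD // -!mulmxA.
  by congr (_ *m (_ *m (_ *m _))); apply: eq_run => k kj;
    rewrite /= bump_lt ?ltnS 1?ltnW // eqSS ltn_eqF // addr0.
have jn : (j <= j + n)%N by exact: leq_addr.
have bE : b' (j + n)%N = b (j + n).+1 by rewrite /b' (bump_ge jn) gtn_eqF ?ltnS // addr0.
have gE : g' (j + n)%N = g (j + n).+1 by rewrite /g' /= (bump_ge jn).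
by rewrite addnS; exact: run_step.
Qed.

(** With [b i = 0], the factors of angles [g i] and [g i.+1] become adjacent. The strict bound
    [i < q] provides the layer [i.+1] that absorbs [g i]. *)
Lemma run_merge_gamma b g i q : b i = 0 -> (i < q)%N ->
  run b g q.+1 = run (b \o bump i) (fun k => g (bump i k) + (g i) *+ (k == i)) q.
Proof.
move=> bi0 iq; set b' := b \o _; set g' := fun k => _.
rewrite -(subnK iq) addnC; elim: (q - i.+1)%N => [|n IH].
  rewrite addn0 [LHS]/= bi0 evo0 // mul1mx [RHS]/= /b' /g' /= eqxx mulr1n.
  rewrite (bump_ge (leqnn i)) evoD // -!mulmxA.
  congr (_ *m (_ *m (_ *m _))); apply: eq_run => k ki; rewrite /= bump_lt //.
  by rewrite ltn_eqF // addr0.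
have iin : (i < i.+1 + n)%N by rewrite ltnS leq_addr.
have bE : b' (i.+1 + n)%N = b (i.+1 + n).+1 by rewrite /b' /= (bump_ge (ltnW iin)).
have gE : g' (i.+1 + n)%N = g (i.+1 + n).+1.
  by rewrite /g' (bump_ge (ltnW iin)) gtn_eqF // addr0.
move: IH; rewrite addnS -[run b' g' _]scale1r -[run b' g' _.+1]scale1r.
exact: run_step.
Qed.

Lemma expect_merge_beta (a : R) b g j q : B *m v0 = a%:C *: v0 -> g j = 0 ->
  (j <= q)%N -> expect A (run b g q.+1) = expect A
    (run (fun k => b (bump j k) + (b j) *+ (k.+1 == j)) (g \o bump j) q).
Proof. by move=> Bv0 gj jq; have [t ->] := run_merge_beta b Bv0 gj jq; exact: expect_phase. Qed.

(** For [i = q] there is no later layer to merge with; the last factor is then removed by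
    [expect_evo], as the observable is [A] itself. *)
Lemma expect_merge_gamma b g i q : b i = 0 -> (i <= q)%N ->
  expect A (run b g q.+1) = expect A
    (run (b \o bump i) (fun k => g (bump i k) + (g i) *+ (k == i)) q).
Proof.
move=> bi0; rewrite leq_eqVlt => /orP[/eqP <-|iq]; last first.
  by congr (expect A _); exact: run_merge_gamma.
rewrite /= bi0 evo0 // mul1mx expect_evo //; congr (expect A _).
by apply: eq_run => k ki; rewrite /= bump_lt // ltn_eqF // addr0.
Qed.

End run.

(** * Expectations as trigonometric polynomials in the angles *)

Section trigonometric.
Variables (R : realType) (m : nat).
Local Notation C := R[i].
Local Open Scope sesquilinear_scope.
Implicit Types (f g : 'rV[R]_m -> C).

Definition ctrig f :=
  trigpoly (fun x => complex.Re (f x)) /\ trigpoly (fun x => complex.Im (f x)).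

Lemma ctrig_cst c : ctrig (fun=> c). Proof. by split; constructor. Qed.

Lemma trig_opp (h : 'rV[R]_m -> R) : trigpoly h -> trigpoly (fun x => - h x).
Proof.
move=> th; rewrite (_ : (fun x => _) = (fun x => -1 * h x)).
  by apply: trig_mul => //; constructor.
by apply/funext => x; rewrite mulN1r.
Qed.

Lemma ctrig_add f g : ctrig f -> ctrig g -> ctrig (fun x => f x + g x).
Proof.
move=> [f1 f2] [g1 g2]; split.
  rewrite (_ : (fun x => _) = (fun x => complex.Re (f x) + complex.Re (g x))).
    exact: trig_add.
  by apply/funext => x; case: (f x) (g x) => [? ?] [? ?].
rewrite (_ : (fun x => _) = (fun x => complex.Im (f x) + complex.Im (g x))).
  exact: trig_add.
by apply/funext => x; case: (f x) (g x) => [? ?] [? ?].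
Qed.

Lemma ctrig_mul f g : ctrig f -> ctrig g -> ctrig (fun x => f x * g x).
Proof.
move=> [f1 f2] [g1 g2]; split.
  rewrite (_ : (fun x => _) = (fun x => complex.Re (f x) * complex.Re (g x)
     + - (complex.Im (f x) * complex.Im (g x)))).
    by apply: trig_add; [|apply: trig_opp]; exact: trig_mul.
  by apply/funext => x; case: (f x) (g x) => [? ?] [? ?].
rewrite (_ : (fun x => _) = (fun x => complex.Re (f x) * complex.Im (g x)
   + complex.Im (f x) * complex.Re (g x))).
  by apply: trig_add; exact: trig_mul.
by apply/funext => x; case: (f x) (g x) => [? ?] [? ?].
Qed.

Lemma ctrig_sum (I : Type) (r : seq I) (f : I -> 'rV[R]_m -> C) :
  (forall l, ctrig (f l)) -> ctrig (fun x => \sum_(l <- r) f l x).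
Proof.
move=> tf; elim: r => [|l r IH].
  rewrite (_ : (fun x => _) = fun=> 0); first exact: ctrig_cst.
  by apply/funext => x; rewrite big_nil.
rewrite (_ : (fun x => _) = fun x => f l x + \sum_(l <- r) f l x).
  exact: ctrig_add.
by apply/funext => x; rewrite big_cons.
Qed.

Lemma ctrig_conj f : ctrig f -> ctrig (fun x => (f x)^*%C).
Proof.
move=> [f1 f2]; split.
  rewrite (_ : (fun x => _) = fun x => complex.Re (f x)) //.
  by apply/funext => x; case: (f x).
rewrite (_ : (fun x => _) = fun x => - complex.Im (f x)); first exact: trig_opp.
by apply/funext => x; case: (f x).
Qed.

Definition ctrigM (p q : nat) (M : 'rV[R]_m -> 'M[C]_(p, q)) :=
  forall i j, ctrig (fun x => M x i j).

Lemma ctrigM_cst p q (M : 'M[C]_(p, q)) : ctrigM (fun=> M).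
Proof. by move=> i j; exact: ctrig_cst. Qed.

Lemma ctrigM_mul p q r (M : 'rV[R]_m -> 'M[C]_(p, q)) (M' : 'rV[R]_m -> 'M[C]_(q, r)) :
  ctrigM M -> ctrigM M' -> ctrigM (fun x => M x *m M' x).
Proof.
move=> tM tM' i j; rewrite (_ : (fun x => _) = fun x => \sum_l M x i l * M' x l j).
  by apply: ctrig_sum => l; exact: ctrig_mul.
by apply/funext => x; rewrite mxE.
Qed.

(** In the eigenbasis the entries are [cis] of a multiple of one coordinate. The zero function is
    allowed because it is the value of [ext] beyond the last layer. *)
Lemma ctrigM_evo N (A : 'M[C]_N) (a : 'rV[R]_m -> R) : A \is hermsymmx ->
  (exists k, a = fun x => x 0 k) \/ a = (fun=> 0) -> ctrigM (fun x => evo A (a x)).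
Proof.
move=> hA [[k ->]|->]; last exact: ctrigM_cst.
have [P [d [_ _ E]]] := evo_spectral hA.
rewrite (_ : (fun x => _) = fun x : 'rV_m =>
  P^t* *m diag_mx (\row_l cis (- (x 0 k * d l))) *m P); last by apply/funext => x.
apply: ctrigM_mul (ctrigM_cst _); apply: ctrigM_mul (ctrigM_cst _) _ => i j.
have [ij|ij] := eqVneq i j; last first.
  rewrite (_ : (fun x => _) = fun=> 0); first exact: ctrig_cst.
  by apply/funext => x; rewrite !mxE (negPf ij).
split.
  rewrite (_ : (fun x => _) = fun x : 'rV[R]_m => cos (- d i * x 0 k)); first by constructor.
  by apply/funext => x; rewrite !mxE ij eqxx mulr1n /= mulNr mulrC.
rewrite (_ : (fun x => _) = fun x : 'rV[R]_m => sin (- d i * x 0 k)); first by constructor.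
by apply/funext => x; rewrite !mxE ij eqxx mulr1n /= mulNr mulrC.
Qed.

Lemma ctrigM_run N (A B : 'M[C]_N) v0 (b g : 'rV[R]_m -> nat -> R) q :
  A \is hermsymmx -> B \is hermsymmx ->
  (forall k, (exists l, b^~ k = fun x => x 0 l) \/ b^~ k = (fun=> 0)) ->
  (forall k, (exists l, g^~ k = fun x => x 0 l) \/ g^~ k = (fun=> 0)) ->
  ctrigM (fun x => run A B v0 (b x) (g x) q).
Proof.
move=> hA hB bP gP; elim: q => [|q IH] /=; first exact: ctrigM_cst.
apply: ctrigM_mul; first by apply: (@ctrigM_evo _ B (b^~ q)).
by apply: ctrigM_mul => //; apply: (@ctrigM_evo _ A (g^~ q)).
Qed.

Lemma trig_expect N (A : 'M[C]_N) (v : 'rV[R]_m -> 'cV[C]_N) :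
  ctrigM v -> trigpoly (fun x => expect A (v x)).
Proof.
move=> tv; suff /(_ 0 0)[] : ctrigM (fun x => (v x)^t* *m A *m v x) by [].
have tv1 := tv; apply: ctrigM_mul tv1; apply: ctrigM_mul (ctrigM_cst _) => i j.
rewrite (_ : (fun x => _) = fun x => (v x j i)^*%C); first exact: (ctrig_conj (tv j i)).
by apply/funext => x; rewrite !mxE.
Qed.

End trigonometric.

(** * The qubit Hamiltonians *)

Section qubits.
Variables (R : realType) (n : nat).
Local Notation C := R[i].
Local Open Scope sesquilinear_scope.

Lemma hermitian_real_sym (N : nat) (A : 'M[C]_N) :
  A^T = A -> (forall i j, (A i j)^*%C = A i j) -> A \is hermsymmx.
Proof.
move=> At Ar; apply/is_hermitianmxP; rewrite expr0 scale1r At.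
by apply/matrixP => i j; rewrite mxE -[in LHS]Ar.
Qed.

Lemma sigma_x_sym (k : 'I_n) : (sigma_x R k)^T = sigma_x R k.
Proof.
apply/matrixP => r c; rewrite !mxE; congr (if _ then _ else _).
by apply: eq_forallb => l; rewrite (eq_sym (qbit l c)).
Qed.

Lemma sigma_zE (k : 'I_n) :
  sigma_z R k = diag_mx (\row_r (if qbit k r then -1 else 1)).
Proof.
by apply/matrixP => r c; rewrite !mxE; case: eqVneq => //= _; rewrite mulr1n.
Qed.

Lemma H_B_herm : H_B R n \is hermsymmx.
Proof.
apply: hermitian_real_sym => [|r c]; rewrite /H_B.
  rewrite linearN linear_sum; congr (- _); apply: eq_bigr => k _.
  exact: sigma_x_sym.
rewrite mxE summxE rmorphN rmorph_sum; congr (- _); apply: eq_bigr => k _.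
by rewrite mxE; case: ifP => _; rewrite ?rmorph1 ?rmorph0.
Qed.

Lemma H_C_herm (e : rel 'I_n) : H_C R e \is hermsymmx.
Proof.
apply: hermitian_real_sym => [|r c]; rewrite /H_C.
  rewrite linear_sum; apply: eq_bigr => i _; rewrite linear_sum; apply: eq_bigr => j _.
  by rewrite !sigma_zE /= trmx_mul !tr_diag_mx diag_mxC.
rewrite summxE rmorph_sum; apply: eq_bigr => i _.
rewrite summxE rmorph_sum; apply: eq_bigr => j _.
rewrite !sigma_zE mulmx_diag !mxE rmorphMn rmorphM; congr (_ * _ *+ _);
  by case: ifP => _; rewrite ?rmorphN1 ?rmorph1.
Qed.

(** Digit 0 is the parity, and the remaining digits are those of the half, to which the induction
    applies. *)
Lemma qbit_inj (q r s : nat) : (r < 2 ^ q)%N -> (s < 2 ^ q)%N ->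
  (forall l, (l < q)%N -> qbit l r = qbit l s) -> r = s.
Proof.
elim: q r s => [|q IH] r s; first by case: r s => [|?] [|?].
move=> rq sq rs.
have half_lt (u : nat) : (u < 2 ^ q.+1)%N -> (u./2 < 2 ^ q)%N.
  by rewrite -divn2 ltn_divLR // -expnSr.
have E : r./2 = s./2.
  apply: IH; [exact: half_lt | exact: half_lt | move=> l lq].
  have := rs l.+1 lq; rewrite /qbit expnS !divnMA !divn2 //.
by rewrite -[r]odd_double_half -[s]odd_double_half E; have := rs 0%N isT;
  rewrite /qbit expn0 !divn1 => ->.
Qed.

(** Each row of [sigma_x] has exactly one nonzero entry. Taking binary digits is injective between
    two sets of size 2^n, hence bijective, so the index with digit [k] flipped exists and is
    unique. *)
Lemma flip_qbit (k : 'I_n) (r : 'I_(2 ^ n)) : exists c : 'I_(2 ^ n),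
  forall c' : 'I_(2 ^ n),
    [forall l : 'I_n, (qbit l r == qbit l c') == (l != k)] = (c' == c).
Proof.
pose bits (c : 'I_(2 ^ n)) := [ffun l : 'I_n => qbit l c].
have binj : injective bits.
  move=> c c' /ffunP cc'; apply/val_inj/(qbit_inj (ltn_ord c) (ltn_ord c')) => l ln.
  by have := cc' (Ordinal ln); rewrite !ffunE.
have [inv invK bitsK] : bijective bits.
  by apply: inj_card_bij binj _; rewrite card_ffun card_bool !card_ord.
exists (inv [ffun l : 'I_n => qbit l r (+) (l == k)]) => c'.
rewrite -(can_eq invK) bitsK.
apply/forallP/eqP => [h|/ffunP h l].
  apply/ffunP => l; rewrite !ffunE; have := h l.
  by case: (l == k) (qbit l r) (qbit l c') => [] [] [].
by have := h l; rewrite !ffunE => ->; case: (l == k) (qbit l r) => [] [].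
Qed.

(** Each row of [sigma_x] sums to 1 and [plus_state] is a constant vector, hence fixed by every
    [sigma_x]. This supplies the eigenvector hypothesis of [run_merge_beta]. *)
Lemma H_B_plus : H_B R n *m plus_state R n = (- n%:R)%:C *: plus_state R n.
Proof.
rewrite /H_B mulNmx mulmx_suml rmorphN scaleNr; congr (- _).
rewrite rmorph_nat scaler_nat.
have -> : plus_state R n *+ n = \sum_(k < n) plus_state R n by rewrite sumr_const card_ord.
apply: eq_bigr => k _.
apply/colP => r; rewrite mxE [RHS]mxE; have [c cP] := flip_qbit k r.
rewrite (bigD1 c) //= big1 ?addr0 => [|c' c'c]; rewrite !mxE cP.
  by rewrite eqxx mul1r.
by rewrite (negPf c'c) mul0r.
Qed.

End qubits.

(** * Symmetric matrices with one negative eigenvalue *)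

Section inertia.
Variables (R : realType) (m : nat).
Local Notation C := R[i].
Local Open Scope sesquilinear_scope.
Implicit Types (M : 'M[R]_m) (w : 'rV[R]_m).

Lemma real_sym_diag M : M^T = M ->
  exists (P : 'M[C]_m) (d : 'I_m -> R), [/\ P *m P^t* = 1%:M,
    map_mx (real_complex R) M = P^t* *m diag_mx (\row_k (d k)%:C) *m P &
    char_poly M = \prod_k ('X - (d k)%:P)].
Proof.
move=> sM; have hM : map_mx (real_complex R) M \is hermsymmx.
  apply: hermitian_real_sym => [|i j]; first by rewrite map_trmx sM.
  by rewrite mxE; exact: conjc_real.
have [P [d [PP ME _]]] := evo_spectral hM; exists P, d; split => //.
apply: (map_poly_inj (real_complex R)); rewrite map_char_poly ME.
have QP : P^t* *m P = 1%:M by exact: mulmx1C.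
have simE (D : 'M[C]_m) : char_poly (P^t* *m D *m P) = char_poly D.
  rewrite /char_poly /char_poly_mx.
  have PPp : map_mx polyC (P^t*) *m map_mx polyC P = 1%:M by rewrite -map_mxM QP map_mx1.
  have -> : 'X%:M - map_mx polyC (P^t* *m D *m P) =
      map_mx polyC (P^t*) *m ('X%:M - map_mx polyC D) *m map_mx polyC P.
    rewrite mulmxBr mulmxBl !map_mxM; congr (_ - _).
    by rewrite scalar_mxC -mulmxA PPp mulmx1.
  by rewrite !det_mulmx mulrAC -det_mulmx PPp det1 mul1r.
rewrite simE char_poly_trig; last by apply/is_trig_mxP => i j ij; rewrite mxE -val_eqE /= ltn_eqF.
rewrite rmorph_prod; apply: eq_bigr => k _.
by rewrite !mxE eqxx mulr1n rmorphB /= map_polyX map_polyC.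
Qed.

Definition sqnorm (z : C) : R := complex.Re z ^+ 2 + complex.Im z ^+ 2.

Lemma sqnorm_ge0 z : 0 <= sqnorm z.
Proof. by rewrite addr_ge0 ?sqr_ge0. Qed.

Lemma sqnorm_eq0 z : (sqnorm z == 0) = (z == 0).
Proof. by rewrite paddr_eq0 ?sqr_ge0 // !sqrf_eq0 eq_complex. Qed.

Lemma Re_sum (I : Type) (r : seq I) (f : I -> C) :
  complex.Re (\sum_(k <- r) f k) = \sum_(k <- r) complex.Re (f k).
Proof. by apply: (big_morph (@complex.Re R)) => // -[? ?] [? ?]. Qed.

Lemma Re_diag_form (d : 'I_m -> R) (c : 'rV[C]_m) :
  complex.Re ((c *m diag_mx (\row_k (d k)%:C) *m c^t*) 0 0) = \sum_k d k * sqnorm (c 0 k).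
Proof.
rewrite mxE Re_sum /=; apply: eq_bigr => k _.
rewrite mul_mx_diag !mxE /sqnorm; case: (c 0 k) => x y /=; simpc => /=.
by rewrite !expr2 mulrDr; congr (_ + _); rewrite mulrAC mulrC // mulrA.
Qed.

(** Carries a sign known for the form on real vectors over to the complex vectors spanned by the
    rows of [P]. *)
Lemma Re_real_form M (c : 'rV[C]_m) :
  complex.Re ((c *m map_mx (real_complex R) M *m c^t*) 0 0) =
  (map_mx (@complex.Re R) c *m M *m (map_mx (@complex.Re R) c)^T) 0 0 +
  (map_mx (@complex.Im R) c *m M *m (map_mx (@complex.Im R) c)^T) 0 0.
Proof.
rewrite !mxE Re_sum -big_split /=.
apply: eq_bigr => k _; rewrite !mxE.
rewrite !mulr_suml Re_sum -big_split /=.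
apply: eq_bigr => l _; rewrite !mxE.
by case: (c 0 l) (c 0 k) => [x y] [x' y'] /=; simpc.
Qed.

(** A dimension count in the style of Courant-Fischer: the hyperplane [w 0 t = 0] leaves room for at
    most one negative eigenvalue, while invertibility and [w0] force at least one. *)
Lemma index_one M (t : 'I_m) (w0 : 'rV[R]_m) : M^T = M -> \det M != 0 ->
  (forall w, w 0 t = 0 -> 0 <= (w *m M *m w^T) 0 0) ->
  w0 != 0 -> (w0 *m M *m w0^T) 0 0 <= 0 ->
  exists lam : R, [/\ lam < 0, eigenvalue M lam,
    mup lam (char_poly M) = 1%N &
    forall mu : R, eigenvalue M mu -> mu != lam -> 0 < mu].
Proof.
move=> sM dM Mpos w00 Mw0.
have [P [d [PP ME cE]]] := real_sym_diag sM.
have QP : P^t* *m P = 1%:M by exact: mulmx1C.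
(* The constant coefficient of the characteristic polynomial is the determinant up to sign. *)
have d0 k : d k != 0.
  apply: contra dM => /eqP dk0.
  have : (char_poly M).[0] = 0 by rewrite cE horner_prod (bigD1 k) //= !hornerE dk0 oppr0 mul0r.
  by rewrite horner_coef0 char_poly_det => /eqP; rewrite mulf_eq0 signr_eq0.
have formE (c : 'rV[C]_m) :
    complex.Re (((c *m P) *m map_mx (real_complex R) M *m (c *m P)^t*) 0 0) =
    \sum_k d k * sqnorm (c 0 k).
  rewrite -Re_diag_form ME trmx_mul map_mxM; congr (complex.Re (_ 0 0)).
  by rewrite -!mulmxA (mulmxA P (P^t*)) PP mul1mx (mulmxA P (P^t*)) PP mul1mx.
(* Were all eigenvalues positive, the form would be positive definite and [w0] would vanish. *)
have [k0 dk0] : exists k, d k < 0.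
  apply/existsP; rewrite -[X in is_true X]negbK negb_exists; apply/negP => /forallP dpos.
  have {}dpos k : 0 < d k by rewrite lt_neqAle eq_sym d0 leNgt dpos.
  pose c := map_mx (real_complex R) w0 *m P^t*.
  have cP : c *m P = map_mx (real_complex R) w0 by rewrite -mulmxA QP mulmx1.
  have := formE c; rewrite cP Re_real_form.
  have -> : map_mx (@complex.Re R) (map_mx (real_complex R) w0) = w0.
    by apply/matrixP => i j; rewrite !mxE.
  have -> : map_mx (@complex.Im R) (map_mx (real_complex R) w0) = 0.
    by apply/matrixP => i j; rewrite !mxE.
  rewrite !mul0mx [X in _ + X]mxE addr0 => sE.
  have sge k : 0 <= d k * sqnorm (c 0 k) by rewrite mulr_ge0 ?sqnorm_ge0 // ltW.
  have s0 : \sum_k d k * sqnorm (c 0 k) = 0.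
    by apply/le_anti; rewrite -{1}sE Mw0 sumr_ge0.
  have c0 : c = 0.
    apply/rowP => k; rewrite [RHS]mxE; apply/eqP; rewrite -sqnorm_eq0.
    have /eqP := s0; rewrite psumr_eq0 // => /allP/(_ k (mem_index_enum k)).
    by rewrite /= mulf_eq0 (negPf (d0 k)).
  move/negP: w00; apply; apply/eqP; apply: (@map_mx_inj _ _ (real_complex R)).
  by rewrite -cP c0 mul0mx map_mx0.
(* A second negative eigenvalue would make the form negative definite on the plane of two
   eigenvectors, and every plane meets the hyperplane in a nonzero vector. *)
have dpos l : l != k0 -> 0 < d l.
  move=> lk; rewrite lt_neqAle eq_sym d0 leNgt /=; apply/negP => dl.
  pose a := P k0 t; pose b := P l t.
  (* The pair [(- b, a)] kills coordinate [t] of the combination; it could be zero when [a = 0], and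
     then [(1, 0)] does. *)
  have [x [y [xy0 xyt]]] : exists x y : C, (x != 0 \/ y != 0) /\ x * a + y * b = 0.
    have [a0|a0] := eqVneq a 0.
      by exists 1, 0; rewrite oner_eq0 a0 mulr0 mul0r addr0; split; [left|].
    by exists (- b), a; split; [right | rewrite mulNr mulrC addNr].
  pose c : 'rV[C]_m := \row_k (if k == k0 then x else if k == l then y else 0).
  have cPt : (c *m P) 0 t = 0.
    rewrite mxE (bigD1 k0) //= (bigD1 l) //= big1 => [|k /andP[kk0 kl]].
      by rewrite !mxE eqxx (negPf lk) eqxx addr0.
    by rewrite mxE (negPf kk0) (negPf kl) mul0r.
  have : 0 <= \sum_k d k * sqnorm (c 0 k).
    rewrite -formE Re_real_form addr_ge0 // Mpos // mxE cPt //.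
  rewrite (bigD1 k0) //= (bigD1 l) //= big1 => [|k /andP[kk0 kl]]; last first.
    by rewrite mxE (negPf kk0) (negPf kl) /sqnorm /= expr0n /= addr0 mulr0.
  rewrite !mxE eqxx (negPf lk) eqxx addr0; apply/negP; rewrite -ltNge.
  have le1 : d k0 * sqnorm x <= 0 by rewrite nmulr_rle0 ?sqnorm_ge0.
  have le2 : d l * sqnorm y <= 0 by rewrite nmulr_rle0 ?sqnorm_ge0.
  case: xy0 => nz.
    by apply: ltr_wnDr => //; rewrite nmulr_rlt0 // lt_neqAle sqnorm_ge0 eq_sym sqnorm_eq0 nz.
  by apply: ltr_wnDl => //; rewrite nmulr_rlt0 // lt_neqAle sqnorm_ge0 eq_sym sqnorm_eq0 nz.
have rootE mu : eigenvalue M mu = [exists k, mu == d k].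
  rewrite eigenvalue_root_char cE rootE horner_prod prodf_seq_eq0.
  apply/hasP/existsP => [[k _ /=]|[k /eqP ->]].
    by rewrite !hornerE subr_eq0 => muk; exists k.
  by exists k; rewrite ?mem_index_enum // !hornerE subrr.
exists (d k0); split => //.
- by rewrite rootE; apply/existsP; exists k0.
(* The other roots are positive, so [d k0] is not a root of the remaining product. *)
- rewrite cE (bigD1 k0) //= mupMl; last first.
    rewrite /root horner_prod prodf_seq_neq0; apply/allP => k _; apply/implyP => kk0.
    by rewrite !hornerE subr_eq0 lt_eqF // (lt_trans dk0) // dpos.
  by have := mup_XsubCX 1 (d k0) (d k0); rewrite expr1 eqxx.
- move=> mu; rewrite rootE => /existsP[k /eqP ->] kk0; apply: dpos.
  by apply: contraNneq kk0 => ->.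
Qed.

End inertia.

(** * The QAOA energy *)

Transparent evo.

Section qaoa_energy.
Variables (R : realType) (n : nat) (e : rel 'I_n).
Local Notation C := R[i].

(** The default 0 beyond the last angle is never read by [run] at depth [q]. *)
Definition ext (q : nat) (v : 'rV[R]_q) (k : nat) : R := oapp (v 0) 0 (insub k).

Lemma extE q (v : 'rV[R]_q) (k : 'I_q) : ext v k = v 0 k.
Proof. by rewrite /ext valK. Qed.

Lemma foldl_run N (A B : 'M[C]_N) v0 (b g : nat -> R) q :
  foldl (fun v (k : 'I_q) => evo B (b k) *m (evo A (g k) *m v)) v0 (enum 'I_q)
  = run A B v0 b g q.
Proof.
have -> : run A B v0 b g q =
    foldl (fun v k => evo B (b k) *m (evo A (g k) *m v)) v0 (iota 0 q).
  elim: q => // q IH; rewrite runS IH.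
  have -> : iota 0 q.+1 = rcons (iota 0 q) q by rewrite -cats1 -[in LHS]addn1 iotaD.
  by rewrite foldl_rcons.
rewrite -val_enum_ord; elim: (enum _) v0 => // k s IH v0 /=; exact: IH.
Qed.

Lemma energyE q (x : 'rV[R]_(q + q)) : energy e x =
  expect (H_C R e) (run (H_C R e) (H_B R n) (plus_state R n)
                        (ext (lsubmx x)) (ext (rsubmx x)) q).
Proof.
rewrite -foldl_run.
have -> : (fun (v : 'cV[C]_(2 ^ n)) (k : 'I_q) => evo (H_B R n) (ext (lsubmx x) k) *m
      (evo (H_C R e) (ext (rsubmx x) k) *m v)) =
    (fun (v : 'cV[C]_(2 ^ n)) (k : 'I_q) => evo (H_B R n) (lsubmx x 0 k) *m
      (evo (H_C R e) (rsubmx x 0 k) *m v)).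
  by apply/funext => v; apply/funext => k; rewrite !extE.
rewrite -[foldl _ _ _]/(qaoa_state e x).
by rewrite /energy /expect map_trmx.
Qed.

Lemma trig_energy q : trigpoly (@energy R n e q).
Proof.
rewrite (funext (@energyE q)).
apply: trig_expect; apply: ctrigM_run; [exact: H_C_herm | exact: H_B_herm | |] => k;
  rewrite /ext; case: insubP => [l _ _|_] /=; try by right.
- by left; exists (lshift q l); apply/funext => x; rewrite mxE.
- by left; exists (rshift q l); apply/funext => x; rewrite mxE.
Qed.

(** * Merging layers at a vanishing angle *)

Variable p : nat.
Implicit Types x : 'rV[R]_(p.+1 + p.+1).

(* For j = 0 no k satisfies k.+1 = j: the first mixer is dropped. *)
Definition merge_beta (j : 'I_p.+1) x : 'rV[R]_(p + p) :=
  row_mx (\row_k (lsubmx x 0 (lift j k) + lsubmx x 0 j *+ (k.+1 == j)))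
         (\row_k rsubmx x 0 (lift j k)).

(* For i = p no k < p equals i: the last phase factor is dropped. *)
Definition merge_gamma (i : 'I_p.+1) x : 'rV[R]_(p + p) :=
  row_mx (\row_k lsubmx x 0 (lift i k))
         (\row_k (rsubmx x 0 (lift i k) + rsubmx x 0 i *+ (k == i :> nat))).

Lemma merge_beta_line j (t : R) v x :
  merge_beta j (t *: v + x) = t *: merge_beta j v + merge_beta j x.
Proof.
rewrite /merge_beta scale_row_mx add_row_mx; congr row_mx; apply/rowP => k; rewrite !mxE //.
by rewrite mulrnDl -mulrnAr mulrDr addrACA.
Qed.

Lemma merge_gamma_line i (t : R) v x :
  merge_gamma i (t *: v + x) = t *: merge_gamma i v + merge_gamma i x.
Proof.
rewrite /merge_gamma scale_row_mx add_row_mx; congr row_mx; apply/rowP => k; rewrite !mxE //.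
by rewrite mulrnDl -mulrnAr mulrDr addrACA.
Qed.

Lemma energy_merge_beta j x : rsubmx x 0 j = 0 -> energy e x = energy e (merge_beta j x).
Proof.
move=> xj; rewrite !energyE /merge_beta row_mxKl row_mxKr.
have gj : ext (rsubmx x) j = 0 by rewrite extE.
rewrite (expect_merge_beta (H_C_herm R e) (H_B_herm R n) (ext (lsubmx x))
  (H_B_plus R n) gj (leq_ord j)).
congr (expect _ _); apply: eq_run => k kp; rewrite -[k]/(val (Ordinal kp));
  move: (Ordinal kp) => {kp}k; by rewrite [RHS]extE mxE -(extE _ (lift j k)) -?(extE _ j).
Qed.

Lemma energy_merge_gamma i x : lsubmx x 0 i = 0 -> energy e x = energy e (merge_gamma i x).
Proof.
move=> xi; rewrite !energyE /merge_gamma row_mxKl row_mxKr.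
have bi : ext (lsubmx x) i = 0 by rewrite extE.
rewrite (expect_merge_gamma _ (H_C_herm R e) (H_B_herm R n) (ext (rsubmx x)) bi (leq_ord i)).
congr (expect _ _); apply: eq_run => k kp; rewrite -[k]/(val (Ordinal kp));
  move: (Ordinal kp) => {kp}k; by rewrite [RHS]extE mxE -(extE _ (lift i k)) -?(extE _ i).
Qed.

Lemma insert0_id (v : 'rV[R]_p) i : insert0 v i 0 i = 0.
Proof. by rewrite mxE unlift_none. Qed.

Lemma insert0_lift (v : 'rV[R]_p) i k : insert0 v i 0 (lift i k) = v 0 k.
Proof. by rewrite mxE liftK. Qed.

(** Skipping one of two adjacent positions gives the same reindexing except at [k = i], the case of
    [lift_here]. *)
Lemma lift_next (i j : 'I_p.+1) (k : 'I_p) : val j = (val i).+1 -> k != i :> nat ->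
  lift j k = lift i k.
Proof.
move=> ji ki; apply/val_inj; rewrite /= /bump ji; congr (_ + _)%N.
by rewrite ltn_neqAle eq_sym ki.
Qed.

Lemma lift_here (i j : 'I_p.+1) (k : 'I_p) : val j = (val i).+1 -> k = i :> nat ->
  lift j k = i /\ lift i k = j.
Proof.
move=> ji ki; split; apply/val_inj; rewrite /= /bump ?ji ki ?ltnn ?leqnn //.
Qed.

(** Here the restriction on [j] enters: of beta_j and its predecessor, one is the inserted zero,
    namely beta_j if j = i and the predecessor if j = i+1. Their sum is thus the original angle. *)
Lemma merge_beta_ts (xs : 'rV[R]_(p + p)) (i j : 'I_p.+1) :
  (val j == val i) || (val j == (val i).+1) -> merge_beta j (ts_point xs i j) = xs.
Proof.
move=> ij; rewrite /merge_beta /ts_point row_mxKl row_mxKr -[RHS]hsubmxK.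
congr row_mx; apply/rowP => k; rewrite [LHS]mxE; last exact: insert0_lift.
case/orP: ij => /eqP ji.
  by rewrite (val_inj ji) insert0_id insert0_lift mul0rn addr0.
have [ki|ki] := eqVneq (val k) (val i).
  have [-> ljk] := lift_here ji ki.
  by rewrite insert0_id add0r ji ki eqxx mulr1n -ljk insert0_lift.
by rewrite (lift_next ji ki) insert0_lift ji eqSS (negPf ki) addr0.
Qed.

(** Likewise, the inserted zero is gamma_i if j = i and its successor if j = i+1. *)
Lemma merge_gamma_ts (xs : 'rV[R]_(p + p)) (i j : 'I_p.+1) :
  (val j == val i) || (val j == (val i).+1) -> merge_gamma i (ts_point xs i j) = xs.
Proof.
move=> ij; rewrite /merge_gamma /ts_point row_mxKl row_mxKr -[RHS]hsubmxK.
congr row_mx; apply/rowP => k; rewrite [LHS]mxE; first exact: insert0_lift.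
case/orP: ij => /eqP ji.
  by rewrite -(val_inj ji) insert0_id insert0_lift mul0rn addr0.
have [ki|ki] := eqVneq (val k) (val i).
  have [lji ->] := lift_here ji ki.
  by rewrite insert0_id add0r mulr1n -lji insert0_lift.
by rewrite -(lift_next ji ki) insert0_lift addr0.
Qed.

(* Spans the kernel of [merge_beta j] on the hyperplane gamma_j = 0. *)
Definition flat_dir (j : 'I_p.+1) : 'rV[R]_(p.+1 + p.+1) :=
  row_mx (\row_k ((k == j)%:R - (k.+1 == j)%:R)) 0.

Lemma flat_dir_neq0 j : flat_dir j != 0.
Proof.
apply/eqP => /rowP/(_ (lshift p.+1 j)); rewrite row_mxEl !mxE eqxx.
by rewrite (gtn_eqF (ltnSn j)) subr0 => /eqP; rewrite oner_eq0.
Qed.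

(** Raising beta_j and lowering its predecessor by the same amount keeps their sum; for j = 0 only
    the angle of the dropped mixer moves. *)
Lemma merge_beta_flat j : merge_beta j (flat_dir j) = 0.
Proof.
rewrite /merge_beta /flat_dir row_mxKl row_mxKr -[RHS]hsubmxK.
congr row_mx; apply/rowP => k; rewrite !mxE //.
rewrite eqxx (gtn_eqF (ltnSn j)) subr0 eq_sym (negPf (neq_lift j k)) sub0r.
(* [lift j] fixes [k] below [j]; from [j] on, both sides are false. *)
have -> : ((lift j k).+1 == j) = (k.+1 == j).
  rewrite /= /bump; case: leqP => // jk.
  by rewrite !gtn_eqF // !ltnS // ltnW.
by rewrite addNr.
Qed.

Lemma local_min_line (f : 'rV[R]_(p + p) -> R) (xs u : 'rV[R]_(p + p)) : local_min f xs ->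
  \forall t \near (0 : R), f xs <= f (t *: u + xs).
Proof.
move=> fmin; have cu : (fun t : R => t *: u + xs) @ (0 : R) --> 0 *: u + xs.
  by apply: cvgD; [apply: cvgZr_tmp; exact: cvg_id | exact: cvg_cst].
by rewrite scale0r add0r in cu; exact: (cu (fun y => f xs <= f y) fmin).
Qed.

End qaoa_energy.

(* Vertices 1..n and positions 1..p+1 of the paper are 0..n-1 and 0..p here. *)
Theorem theorem2 (R : realType) (n : nat) (hn : (0 < n)%N)
  (e : rel 'I_n) (e_sym : symmetric e) (e_irr : irreflexive e)
  (p : nat) (hp : (0 < p)%N) (xstar : 'rV[R]_(p + p))
  (hmin : local_min (energy e (q := p)) xstar) :
  forall i j : 'I_p.+1, (val j == val i) || (val j == (val i).+1) ->
    transition_state (energy e (q := p.+1)) (ts_point xstar i j) \/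
    \det (hessian (energy e (q := p.+1)) (ts_point xstar i j)) = 0.
Proof.
move=> i j ij; set F := @energy R n e p.+1; set x := ts_point xstar i j.
have [dH|dH] := eqVneq (\det (hessian F x)) 0; [by right | left].
have tF : trigpoly F by exact: trig_energy.
have xj : rsubmx x 0 j = 0 by rewrite /x /ts_point row_mxKr insert0_id.
have xi : lsubmx x 0 i = 0 by rewrite /x /ts_point row_mxKl insert0_id.
have xb : merge_beta j x = xstar by exact: merge_beta_ts.
have xg : merge_gamma i x = xstar by exact: merge_gamma_ts.
clearbody x.
have Fx : F x = energy e xstar by rewrite -xb; exact: energy_merge_beta.
have line_beta v t : rsubmx v 0 j = 0 ->
    F (t *: v + x) = energy e (t *: merge_beta j v + xstar).
  move=> vj; have vxj : rsubmx (t *: v + x) 0 j = 0.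
    by move: vj xj; rewrite !mxE => -> ->; rewrite mulr0 addr0.
  by rewrite -xb -merge_beta_line; exact: energy_merge_beta.
have line_gamma v t : lsubmx v 0 i = 0 ->
    F (t *: v + x) = energy e (t *: merge_gamma i v + xstar).
  move=> vi; have vxi : lsubmx (t *: v + x) 0 i = 0.
    by move: vi xi; rewrite !mxE => -> ->; rewrite mulr0 addr0.
  by rewrite -xg -merge_gamma_line; exact: energy_merge_gamma.
(* Inside the hyperplane gamma_j = 0, a line through [x] is mapped to a line through the local
   minimum. *)
have min_beta v : rsubmx v 0 j = 0 ->
    'D_v F x = 0 /\ 0 <= (v *m hessian F x *m v^T) 0 0.
  move=> vj; apply: trig_line_min tF _; rewrite Fx.
  have := local_min_line (merge_beta j v) hmin.
  by apply: filterS => t; rewrite (line_beta v t vj).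
split.
  (* The direction of gamma_j is the only coordinate direction that leaves the hyperplane. It keeps
     beta_i = 0, so [merge_gamma] handles it. *)
  move=> a; have [->|aj] := eqVneq a (rshift p.+1 j).
    have vi : lsubmx (delta_mx 0 (rshift p.+1 j) : 'rV[R]_(p.+1 + p.+1)) 0 i = 0.
      by rewrite !mxE eq_lrshift.
    apply: (proj1 (trig_line_min tF _)); rewrite Fx.
    have := local_min_line (merge_gamma i (delta_mx 0 (rshift p.+1 j))) hmin.
    by apply: filterS => t; rewrite (line_gamma _ t vi).
  by apply: (proj1 (min_beta _ _)); rewrite !mxE eq_sym (negPf aj).
apply: (@index_one _ _ _ (rshift p.+1 j) (flat_dir R j)).
- exact: (trig_hessian_sym x tF).
- exact: dH.
- by move=> w wj; apply: (proj2 (min_beta _ _)); rewrite mxE.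
- exact: flat_dir_neq0.
- have flat0 : rsubmx (flat_dir R j) 0 j = 0 by rewrite row_mxKr mxE.
  (* [merge_beta] sends the line through [x] along [flat_dir] to the single point [xstar], so [F] is
     constant on it. *)
  have -> : (flat_dir R j *m hessian F x *m (flat_dir R j)^T) 0 0 = 0.
    apply: (trig_line_cst tF) => t.
    by rewrite (line_beta _ t flat0) merge_beta_flat scaler0 add0r Fx.
  exact: lexx.
Qed.
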